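(* Let $a_1<a_2<a_3$ be positive integers with $\gcd(a_1,a_2,a_3)=1$, and let $S=\{c_1a_1+c_2a_2+c_3a_3 : c_1,c_2,c_3\in\mathbb{N}\}$ be the numerical semigroup they generate (the set $\{a_1,a_2,a_3\}$ is not assumed to be the minimal generating set of $S$). Put $g=\gcd(a_2-a_1,a_3-a_1)$, $m=(a_2-a_1)/g$ and $n=(a_3-a_1)/g$. If $x$ and $y$ are integers such that $mx+ny=a_1$, then $$\mathrm{d}_{\max}(S)=\left\lceil\frac{x}{n}\right\rceil+\left\lceil\frac{y}{m}\right\rceil.$$
   Context: $\mathbb{N}$ denotes the nonnegative integers. A numerical semigroup $S$ is a subset of $\mathbb{N}$ closed under addition, containing $0$, with finite complement in $\mathbb{N}$. It has a unique minimal generating set $\{b_1<\dots<b_t\}$: the minimal elements of $S\setminus\{0\}$ for the partial order $u\preceq u'$ iff $u'-u\in S$. A factorization of $s\in S$ is a tuple $(c_1,\dots,c_t)\in\mathbb{N}^t$ with $s=c_1b_1+\dots+c_tb_t$, where $b_1<\dots<b_t$ are the minimal generators of $S$; its length is $c_1+\dots+c_t$. A factorization of $s$ is maximal if its length is the largest among all factorizations of $s$. $\mathrm{d}_{\max}(s;S)$ is the number of maximal factorizations of $s$, and $\mathrm{d}_{\max}(S)=\max_{s\in S}\mathrm{d}_{\max}(s;S)$ (this maximum is finite). *)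

(* Defs.v *)
From HB Require Import structures.
From mathcomp Require Import all_boot all_order all_algebra.
From mathcomp Require Import finmap.
From mathcomp Require Import boolp classical_sets functions cardinality.

Set Implicit Arguments.
Unset Strict Implicit.
Unset Printing Implicit Defensive.

Local Open Scope nat_scope.
Local Open Scope classical_set_scope.

Definition numerical_semigroup (S : set nat) : Prop :=
  [/\ S 0, forall u v, S u -> S v -> S (u + v) & finite_set (~` S)].

Definition gen3 (a1 a2 a3 : nat) : set nat :=
  [set s | exists c1 c2 c3 : nat, s = c1 * a1 + c2 * a2 + c3 * a3].

(* u' - u lies in S; as S is a set of naturals, this includes u <= u'. *)
Definition sg_le (S : set nat) (u u' : nat) : Prop := u <= u' /\ S (u' - u).

Definition min_gens (S : set nat) : set nat :=
  [set u | [/\ S u, u != 0 &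
     forall v, S v -> v != 0 -> sg_le S v u -> v = u]].

(* The increasing list b_1 < ... < b_t of minimal generators; [fset_set] is
   meaningful here because [min_gens S] is finite ([finite_min_gens]). *)
Definition gens (S : set nat) : seq nat := sort leq (fset_set (min_gens S)).

Definition factorizations (S : set nat) (s : nat) :
    set ((size (gens S)).-tuple nat) :=
  [set c | s = \sum_(i < size (gens S)) tnth c i * nth 0 (gens S) i].
Arguments factorizations : clear implicits.

Definition fact_length t (c : t.-tuple nat) : nat := \sum_(i < t) tnth c i.

Definition max_factorizations (S : set nat) (s : nat) :
    set ((size (gens S)).-tuple nat) :=
  [set c | factorizations S s c /\
     forall c', factorizations S s c' -> fact_length c' <= fact_length c].
Arguments max_factorizations : clear implicits.

(* The set counted is finite ([finite_factorizations]). *)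
Definition dmax_at (S : set nat) (s : nat) : nat :=
  #|` fset_set (max_factorizations S s)|.

(* [is_dmax S d] reads d_max(S) = d: the maximum is attained and equals d. *)
Definition is_dmax (S : set nat) (d : nat) : Prop :=
  (exists2 s, S s & dmax_at S s = d) /\ (forall s, S s -> dmax_at S s <= d).

Lemma is_dmax_unique (S : set nat) (d d' : nat) :
  is_dmax S d -> is_dmax S d' -> d = d'.
Proof.
move=> [[s Ss <-] Hd] [[s' Ss' <-] Hd'].
by apply/eqP; rewrite eqn_leq Hd' // Hd.
Qed.

Lemma finite_min_gens (S : set nat) :
  numerical_semigroup S -> finite_set (min_gens S).
Proof.
move=> [S0 SD _].
have SM k u : S u -> S (k * u).
  by move=> Su; elim: k => [|k IH]; rewrite ?mul0n // mulSn; apply: SD.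
have [[a [Sa a0 _]]|noa] := pselect (exists a, min_gens S a); last first.
  suff -> : min_gens S = set0 by exact: finite_set0.
  by apply/seteqP; split=> u //= Mu; apply: noa; exists u.
have key u v : min_gens S u -> min_gens S v -> u <= v ->
    u %% a = v %% a -> u = v.
  move=> [Su u0 _] [_ _ vmin] le_uv /eqP eq_uv.
  apply: vmin => //; split => //.
  by move: eq_uv; rewrite eq_sym eqn_mod_dvd // => /dvdnP[k ->]; apply: SM.
have inj : {in min_gens S &, injective (fun u => u %% a)}.
  move=> u v; rewrite !inE => Mu Mv eq_uv.
  have [le_uv|/ltnW le_vu] := leqP u v; first exact: key.
  by apply/esym/key.
have /card_eqPle[_ le_im] := inj_card_eq inj.
apply: card_le_finite le_im _; apply: sub_finite_set (finite_II a).
by move=> _ [u _ <-] /=; rewrite ltn_mod lt0n.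
Qed.

Lemma mem_gens (S : set nat) u :
  numerical_semigroup S -> (u \in gens S) <-> min_gens S u.
Proof.
move=> /finite_min_gens finS; rewrite mem_sort in_fset_set //.
by split; rewrite inE.
Qed.

Lemma gens_sorted (S : set nat) : sorted ltn (gens S).
Proof.
by rewrite ltn_sorted_uniq_leq sort_uniq fset_uniq /= (sort_sorted leq_total).
Qed.

Lemma gens_gt0 (S : set nat) u : u \in gens S -> 0 < u.
Proof.
rewrite mem_sort lt0n; have [finS|infS] := pselect (finite_set (min_gens S)).
  by rewrite in_fset_set // inE => -[].
by rewrite /fset_set; case: pselect => // _; rewrite inE.
Qed.

Lemma finite_factorizations (S : set nat) s : finite_set (factorizations S s).
Proof.
pose t := size (gens S).
pose f (c : t.-tuple 'I_s.+1) : t.-tuple nat := [tuple of map val c].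
apply: (@sub_finite_set _ _ (f @` setT)); last first.
  exact/finite_image/finite_finset.
move=> c /= Hc; exists [tuple of map inord c] => //.
apply: eq_from_tnth => i; rewrite !tnth_map /= inordK //.
rewrite ltnS Hc (bigD1 i) //=.
by apply: leq_trans (leq_addr _ _); exact/leq_pmulr/gens_gt0/mem_nth.
Qed.

Lemma gen3_numerical_semigroup (a1 a2 a3 : nat) :
  0 < a1 -> gcdn a1 (gcdn a2 a3) = 1 -> numerical_semigroup (gen3 a1 a2 a3).
Proof.
move=> a1_gt0 gcd1; split; first by exists 0, 0, 0.
  move=> _ _ [c1 [c2 [c3 ->]]] [e1 [e2 [e3 ->]]].
  by exists (c1 + e1), (c2 + e2), (c3 + e3); rewrite !mulnDl addnACA (addnACA (c1 * a1)).
rewrite gcdnA in gcd1.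
have [e _ He] := Bezoutl a2 a1_gt0.
have g_gt0 : 0 < gcdn a1 a2 by rewrite gcdn_gt0 a1_gt0.
have [f _ Hf] := Bezoutl a3 g_gt0; rewrite gcd1 in Hf.
have /dvdnP[h Eh] := Hf.
pose w := (h * e) * a2 + f * a3.
have dvd_w : a1 %| w + 1.
  have -> : w + 1 = h * (gcdn a1 a2 + e * a2).
    by rewrite /w mulnDr -Eh mulnA -addnA (addnC _ 1) addnC.
  exact: dvdn_mull.
pose r s := (a1 - s %% a1) * w.
have dvd_r s : a1 %| s + (s %% a1) * w.
  rewrite {1}(divn_eq s a1) -addnA dvdn_addr ?dvdn_mull //.
  by rewrite -{1}(muln1 (s %% a1)) -mulnDr (addnC 1) dvdn_mull.
apply: sub_finite_set (finite_II (a1 * w)) => s /= nS.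
rewrite ltnNge; apply/negP => le_s; apply: nS.
have le_r : r s <= s by apply: leq_trans le_s; rewrite leq_mul2r leq_subr orbT.
have /dvdnP[k Ek] : a1 %| s - r s.
  have E : (s - r s) + a1 * w = s + (s %% a1) * w.
    rewrite -{3}(subnK le_r) -addnA /r -mulnDl subnK //.
    exact/ltnW/ltn_pmod.
  by have := dvd_r s; rewrite -E dvdn_addl // dvdn_mulr.
exists k, ((a1 - s %% a1) * (h * e)), ((a1 - s %% a1) * f).
by rewrite -!(mulnA (a1 - _)) -addnA -mulnDr -Ek subnK.
Qed.

(* Main.v *)
(* A redundant generator never occurs in a factorization of maximal length over
   a1, a2, a3, so one may count those over all three, minimal or not. Two
   factorizations of equal length differ by a multiple of (n - m, -n, m).
   Put N = ceil(x/n) + ceil(y/m), r = n ceil(x/n) - x and t = m ceil(y/m) - y;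
   then m r + n t + a1 = N m n, so N n copies of a2 can be replaced by r copies
   of a2, t of a3 and N n + g - r - t of a1, which gains length g. Hence c2 < N n
   in a maximal factorization, and as c2 is determined modulo n there are at most
   N of them. The bound is attained at s = (N - 1) n a2: a longer factorization
   would exceed the length (N - 1) n by some g i with i > 0, and would have
   c2 = i r + u n and c3 = i t + w m with u, w > -i and u + w = N - 1 - i N,
   which is impossible if N > 1; if N = 1, then s = 0. *)
Require Import Defs.
From mathcomp Require Import all_boot all_order all_algebra.
From mathcomp Require Import classical_sets.
From mathcomp Require Import boolp cardinality zify.

Set Implicit Arguments.
Unset Strict Implicit.

(** * Maximal factorizations over a possibly redundant list of generators *)

Section MaximalCoefficients.
Local Open Scope nat_scope.

(** Coefficients are functions on all of [nat], so that one [e] can be read over both [l] and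
    [gens S]; only its values on the list matter. *)
Definition weight (l : seq nat) (e : nat -> nat) : nat := \sum_(a <- l) e a * a.

Definition total (l : seq nat) (e : nat -> nat) : nat := \sum_(a <- l) e a.

Definition max_coefs (l : seq nat) (s : nat) (e : nat -> nat) : Prop :=
  weight l e = s /\ forall e', weight l e' = s -> total l e' <= total l e.

(** Outside [l] the index is [size l] and the default 0 is returned: a tuple over [gens S] is thus
    extended by zero to redundant generators. *)
Definition coefs (l : seq nat) (c : (size l).-tuple nat) (a : nat) : nat :=
  nth 0 c (index a l).

Definition coefs_tuple (l : seq nat) (e : nat -> nat) : (size l).-tuple nat :=
  [tuple e (nth 0 l i) | i < size l].

Lemma weightD l e e' : weight l (fun a => e a + e' a) = weight l e + weight l e'.
Proof. by rewrite /weight -big_split; apply: eq_bigr => a _; rewrite mulnDl. Qed.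

Lemma totalD l e e' : total l (fun a => e a + e' a) = total l e + total l e'.
Proof. by rewrite /total -big_split. Qed.

Lemma weight_delta l a : uniq l -> a \in l -> weight l (fun b => b == a) = a.
Proof.
move=> Ul la; rewrite /weight (bigD1_seq a) //= eqxx mul1n.
by rewrite big1 ?addn0 // => b /negPf ->.
Qed.

Lemma total_delta l a : uniq l -> a \in l -> total l (fun b => b == a) = 1.
Proof.
move=> Ul la; rewrite /total (bigD1_seq a) //= eqxx.
by rewrite big1 ?addn0 // => b /negPf ->.
Qed.

Lemma total_le_weight l e : 0 \notin l -> total l e <= weight l e.
Proof.
move=> l0; rewrite /total /weight !big_seq; apply: leq_sum => a la.
by rewrite leq_pmulr // lt0n; apply: contraNneq l0 => <-.
Qed.

Lemma weight_eq0 l e : total l e = 0 -> weight l e = 0.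
Proof.
move=> /eqP; rewrite sum_nat_seq_eq0 => /allP e0.
by rewrite /weight big_seq big1 // => a /e0 /eqP ->.
Qed.

(** Positive generators bound the total by [s], so a largest total exists. *)
Lemma max_coefs_above l s e : 0 \notin l -> weight l e = s ->
  exists2 e', max_coefs l s e' & total l e <= total l e'.
Proof.
move=> l0 Ee.
pose P k := `[< exists2 e', weight l e' = s & total l e' = k >].
have exP : exists k, P k by exists (total l e); apply/asboolP; exists e.
have leP k : P k -> k <= s.
  by move=> /asboolP[e' <- <-]; exact: total_le_weight.
case: (ex_maxnP exP leP) => k /asboolP[e' Ee' <-] maxk.
exists e'; last by apply: maxk; apply/asboolP; exists e.
by split=> // e2 Ee2; apply: maxk; apply/asboolP; exists e2.
Qed.

Lemma coefs_nth l (c : (size l).-tuple nat) (i : 'I_(size l)) :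
  uniq l -> coefs c (nth 0 l i) = tnth c i.
Proof. by move=> Ul; rewrite /coefs index_uniq // -tnth_nth. Qed.

Lemma coefsK l : uniq l -> cancel (@coefs l) (coefs_tuple l).
Proof.
by move=> Ul c; apply: eq_from_tnth => i; rewrite tnth_mktuple coefs_nth.
Qed.

Lemma coefs_tupleK l e a : a \in l -> coefs (coefs_tuple l e) a = e a.
Proof.
rewrite -index_mem => la; rewrite /coefs.
by rewrite (nth_mktuple _ _ (Ordinal la)) /= nth_index // -index_mem.
Qed.

Lemma coefs_out l (c : (size l).-tuple nat) a : a \notin l -> coefs c a = 0.
Proof.
by move=> la; rewrite /coefs nth_default // size_tuple memNindex.
Qed.

Lemma weight_coefs l (c : (size l).-tuple nat) : uniq l ->
  weight l (coefs c) = \sum_(i < size l) tnth c i * nth 0 l i.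
Proof.
move=> Ul; rewrite /weight (big_nth 0) big_mkord.
by apply: eq_bigr => i _; rewrite coefs_nth.
Qed.

Lemma total_coefs l (c : (size l).-tuple nat) : uniq l ->
  total l (coefs c) = fact_length c.
Proof.
move=> Ul; rewrite /total (big_nth 0) big_mkord.
by apply: eq_bigr => i _; rewrite coefs_nth.
Qed.

Variables (S : set nat) (l : seq nat).
Hypotheses (numS : numerical_semigroup S) (sorted_l : sorted ltn l)
  (l0 : 0 \notin l) (genS : forall s, S s <-> exists e, weight l e = s).

Let uniq_l : uniq l. Proof. exact: sorted_uniq ltn_trans ltnn _ sorted_l. Qed.

Let uniq_gens : uniq (gens S).
Proof. exact: sorted_uniq ltn_trans ltnn _ (gens_sorted S). Qed.

Let genS_mem a : a \in l -> S a.
Proof. by move=> la; apply/genS; exists (fun b => b == a); rewrite weight_delta. Qed.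

(** If [b] occurs in an expression of [a] over [l], then [a - b] is in [S], and minimality of [a]
    forces [b = a]. *)
Lemma gens_sub a : a \in gens S -> a \in l.
Proof.
move=> ga; have [Sa a0 amin] := (mem_gens a numS).1 ga; have [e Ee] := (genS a).1 Sa.
have /hasP[b lb] : has (fun b => e b != 0) l.
  rewrite has_predC; apply: contraNN a0 => /allP e0.
  by rewrite -Ee weight_eq0 // /total big_seq big1 // => b /e0 /eqP.
rewrite -lt0n => eb.
have b0 : b != 0 by apply: contraNneq l0 => <-.
have Sb := genS_mem lb; rewrite -(amin b) //.
have Ea : a = weight l (fun x => e x - (x == b)) + b.
  rewrite -{2}(weight_delta uniq_l lb) -weightD -Ee.
  by apply: eq_bigr => x _; congr (_ * _); case: eqP => [->|_]; lia.
by split; rewrite Ea ?leq_addl // addnK; apply/genS; eexists.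
Qed.

Lemma gens_filter : gens S = [seq a <- l | a \in gens S].
Proof.
apply: (irr_sorted_eq ltn_trans ltnn) => [||a]; first exact: gens_sorted.
  exact: (sorted_filter ltn_trans).
by rewrite mem_filter; case: (boolP (a \in gens S)) => // /gens_sub.
Qed.

(* A redundant generator is a sum of two nonzero elements, so trading one copy
   of it for their coefficients increases the total. *)
Lemma max_coefs_redundant s e a :
  max_coefs l s e -> a \in l -> a \notin gens S -> e a = 0.
Proof.
move=> [Ee maxe] la /negP na; apply/eqP; apply/negPn/negP; rewrite -lt0n => ea.
apply: na; apply/(mem_gens _ numS); split; first exact: genS_mem.
  by apply: contraNneq l0 => <-.
move=> v Sv v0 [le_va Sav]; apply/eqP; apply/negPn/negP => ne_va.
have [[f Ef] [f' Ef']] := ((genS _).1 Sv, (genS _).1 Sav).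
pose h x := (e x - (x == a)) + (f x + f' x).
(* Stated for any additive [T], to serve both [weight l] and [total l]. The subtraction in [h] is
   exact because [0 < e a]. *)
have Eh (T : (nat -> nat) -> nat) : (forall e1 e2, T (fun x => e1 x + e2 x) = T e1 + T e2) ->
    (forall e1 e2, e1 =1 e2 -> T e1 = T e2) ->
    T h + T (fun x => x == a) = T e + (T f + T f').
  move=> TD Text; rewrite -!TD; apply: Text => x; rewrite /h.
  by case: eqP => [->|_]; lia.
have wext e1 e2 : e1 =1 e2 -> weight l e1 = weight l e2.
  by move=> E; apply: eq_bigr => x _; rewrite E.
have text e1 e2 : e1 =1 e2 -> total l e1 = total l e2.
  by move=> E; apply: eq_bigr => x _; rewrite E.
have := Eh _ (weightD l) wext; have := Eh _ (totalD l) text.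
rewrite weight_delta // total_delta // Ef Ef' subnKC // => Th /addIn Wh.
have := maxe h; rewrite Wh Ee => /(_ erefl).
have f0 : total l f <> 0 by move/weight_eq0; move/eqP: v0; lia.
have f'0 : total l f' <> 0 by move/weight_eq0; move/eqP: ne_va; lia.
by lia.
Qed.

Lemma weight_gens e : (forall a, a \in l -> a \notin gens S -> e a = 0) ->
  weight (gens S) e = weight l e.
Proof.
move=> e0; rewrite /weight [in LHS]gens_filter big_filter big_mkcond.
rewrite [LHS]big_seq [RHS]big_seq; apply: eq_bigr => a la.
by case: ifP => // /negbT /(e0 _ la) ->.
Qed.

Lemma total_gens e : (forall a, a \in l -> a \notin gens S -> e a = 0) ->
  total (gens S) e = total l e.
Proof.
move=> e0; rewrite /total [in LHS]gens_filter big_filter big_mkcond.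
rewrite [LHS]big_seq [RHS]big_seq; apply: eq_bigr => a la.
by case: ifP => // /negbT /(e0 _ la) ->.
Qed.

Let weight_coefs_gens (c : (size (gens S)).-tuple nat) :
  weight l (coefs c) = \sum_(i < size (gens S)) tnth c i * nth 0 (gens S) i.
Proof. by rewrite -weight_gens ?weight_coefs // => a _; exact: coefs_out. Qed.

Let total_coefs_gens (c : (size (gens S)).-tuple nat) :
  total l (coefs c) = fact_length c.
Proof. by rewrite -total_gens ?total_coefs // => a _; exact: coefs_out. Qed.

Let coefs_tuple_gensK s e : max_coefs l s e ->
  {in l, coefs (coefs_tuple (gens S) e) =1 e}.
Proof.
move=> maxe a la; case: (boolP (a \in gens S)) => ga; first exact: coefs_tupleK.
by rewrite coefs_out // (max_coefs_redundant maxe).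
Qed.

(** A competitor over [l] may use redundant generators. It is first replaced by a maximal one, which
    uses none and so comes from a tuple over [gens S]. *)
Lemma max_coefs_coefs s c : max_factorizations S s c -> max_coefs l s (coefs c).
Proof.
move=> [Ec maxc]; split; first by rewrite weight_coefs_gens.
move=> e /(max_coefs_above l0)[e' maxe' /leq_trans]; apply.
have cK := coefs_tuple_gensK maxe'.
have -> : total l e' = fact_length (coefs_tuple (gens S) e').
  rewrite -total_coefs_gens /total !big_seq.
  by apply: eq_bigr => a la; rewrite cK.
rewrite total_coefs_gens; apply: maxc.
rewrite /factorizations /= -weight_coefs_gens -[LHS]maxe'.1.
by rewrite /weight !big_seq; apply: eq_bigr => a la; rewrite cK.
Qed.

Lemma max_factorizations_coefs_tuple s e : max_coefs l s e ->
  max_factorizations S s (coefs_tuple (gens S) e).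
Proof.
move=> maxe; have cK := coefs_tuple_gensK maxe.
have [Ee maxe'] := maxe; split.
  rewrite /factorizations /= -weight_coefs_gens -[LHS]Ee.
  by rewrite /weight !big_seq; apply: eq_bigr => a la; rewrite cK.
move=> c Ec; rewrite -!total_coefs_gens.
suff -> : total l (coefs (coefs_tuple (gens S) e)) = total l e.
  by apply: maxe'; rewrite weight_coefs_gens.
by rewrite /total !big_seq; apply: eq_bigr => a la; rewrite cK.
Qed.

(** The label [f] injects the maximal factorizations into the naturals below [N]. *)
Lemma dmax_at_le s N (f : (nat -> nat) -> nat) :
  (forall e, max_coefs l s e -> f e < N) ->
  (forall e e', max_coefs l s e -> max_coefs l s e' -> f e = f e' ->
     {in l, e =1 e'}) ->
  dmax_at S s <= N.
Proof.
move=> fN finj; apply: geq_card_fset_set.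
have inj : {in max_factorizations S s &, injective (fun c => f (coefs c))}.
  move=> c c' /set_mem/max_coefs_coefs Mc /set_mem/max_coefs_coefs Mc' Ef.
  rewrite -(coefsK uniq_gens c) -(coefsK uniq_gens c').
  apply: eq_from_tnth => i; rewrite !tnth_mktuple; apply: finj Ef _ _ => //.
  exact/gens_sub/mem_nth.
have /card_eqPle[_ le_im] := inj_card_eq inj.
apply: card_le_trans le_im _; apply: subset_card_le.
by move=> _ [c /max_coefs_coefs Mc <-] /=; exact: fN.
Qed.

Lemma dmax_at_ge s N (h : nat -> nat -> nat) :
  (forall k, k < N -> max_coefs l s (h k)) ->
  (forall j k, j < N -> k < N -> {in l, h j =1 h k} -> j = k) ->
  N <= dmax_at S s.
Proof.
move=> hmax hinj; apply: leq_card_fset_set.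
  by apply: sub_finite_set (finite_factorizations S s) => c [].
have inj : {in `I_N &, injective (fun k => coefs_tuple (gens S) (h k))}.
  move=> j k /set_mem jN /set_mem kN Ejk; apply: hinj => // a la.
  rewrite -(coefs_tuple_gensK (hmax j jN)) //.
  by rewrite -(coefs_tuple_gensK (hmax k kN)) // Ejk.
have /card_eqPle[_ le_im] := inj_card_eq inj.
apply: card_le_trans le_im _; apply: subset_card_le.
by move=> _ [k kN <-]; exact/max_factorizations_coefs_tuple/hmax.
Qed.

End MaximalCoefficients.

(** The difference [m * (c - c')] is a multiple of [n], and [m] is invertible modulo [n]. *)
Lemma coprime_lin_modn m n c d c' d' : (coprime m n ->
  m * c + n * d = m * c' + n * d' -> c = c' %[mod n])%N.
Proof.
move=> co_mn; wlog le_cc' : c d c' d' / (c' <= c)%N => [W E|E].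
  have [le_c|/ltnW le_c] := leqP c' c; first exact: W E.
  by apply/esym; exact: W (esym E).
apply/eqP; rewrite eqn_mod_dvd // -(Gauss_dvdr (m := n) (n := m)) 1?coprime_sym //.
suff -> : (m * (c - c') = n * (d' - d))%N by rewrite dvdn_mulr.
by rewrite !mulnBr; lia.
Qed.

(** * Maximal coefficients over three generators *)

Section ThreeGenerators.
Local Open Scope nat_scope.

Variables (a1 g m n : nat).
Hypotheses (a1_gt0 : 0 < a1) (g_gt0 : 0 < g) (m_gt0 : 0 < m) (lt_mn : m < n).

Let a2 := a1 + g * m.
Let a3 := a1 + g * n.
Let l := [:: a1; a2; a3].
Let lt12 : a1 < a2. Proof. by rewrite /a2; nia. Qed.
Let lt23 : a2 < a3. Proof. by rewrite /a2 /a3; nia. Qed.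

Definition coefs3 (c1 c2 c3 a : nat) : nat :=
  if a == a1 then c1 else if a == a2 then c2 else c3.

Let weightE e : weight l e = e a1 * a1 + e a2 * a2 + e a3 * a3.
Proof. by rewrite /weight !big_cons big_nil addn0 addnA. Qed.

Let totalE e : total l e = e a1 + e a2 + e a3.
Proof. by rewrite /total !big_cons big_nil addn0 addnA. Qed.

Let coefs3E c1 c2 c3 :
  (coefs3 c1 c2 c3 a1 = c1) * (coefs3 c1 c2 c3 a2 = c2) *
  (coefs3 c1 c2 c3 a3 = c3).
Proof.
rewrite /coefs3 !eqxx (gtn_eqF lt12) (gtn_eqF lt23).
by rewrite (gtn_eqF (ltn_trans lt12 lt23)).
Qed.

(** Hence weight and total together determine [m * e a2 + n * e a3]. *)
Let weight_total e :
  weight l e = total l e * a1 + g * (m * e a2 + n * e a3).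
Proof. by rewrite weightE totalE /a2 /a3; lia. Qed.

(** Equal totals fix [m * e a2 + n * e a3], hence [e a2] modulo [n]; the quotient then fixes [e a2],
    and with it the other two coefficients. *)
Lemma max_coefs_inj s e e' : coprime m n -> max_coefs l s e -> max_coefs l s e' ->
  e a2 %/ n = e' a2 %/ n -> {in l, e =1 e'}.
Proof.
move=> co_mn [Ee maxe] [Ee' maxe'] Ediv.
have ET : total l e = total l e'.
  by apply/eqP; rewrite eqn_leq maxe // maxe'.
have /eqP : g * (m * e a2 + n * e a3) = g * (m * e' a2 + n * e' a3).
  by apply/eqP; rewrite -(eqn_add2l (total l e * a1)) {2}ET -!weight_total Ee Ee'.
rewrite eqn_pmul2l // => /eqP EM.
have E2 : e a2 = e' a2.
  rewrite (divn_eq (e a2) n) (divn_eq (e' a2) n) Ediv; congr (_ + _).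
  exact: coprime_lin_modn EM.
have E3 : e a3 = e' a3.
  by apply/eqP; rewrite -(eqn_pmul2l (ltn_trans m_gt0 lt_mn)) -(eqn_add2l (m * e a2)) EM E2.
have E1 : e a1 = e' a1 by move: ET; rewrite !totalE; lia.
by move=> a; rewrite !inE => /or3P[] /eqP ->.
Qed.

Variables (N r t : nat).
Hypothesis Ea1 : m * r + n * t + a1 = N * m * n.

Lemma max_coefs_lt s e : max_coefs l s e -> e a2 < N * n.
Proof.
move=> [Ee maxe]; rewrite ltnNge; apply/negP => le_e2.
(* Since [m < n], [m * (r + t) <= m * r + n * t <= N * m * n]; so the subtractions in [K] are
   exact. *)
have le_rt : r + t <= N * n by nia.
pose K := N * n + g - r - t.
have EK : K + r + t = N * n + g by rewrite /K; lia.
pose e' := coefs3 (e a1 + K) (e a2 - N * n + r) (e a3 + t).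
have Ed : (e a2 - N * n) + N * n = e a2 by rewrite subnK.
have Te : total l e' = total l e + g.
  by rewrite !totalE /e' !coefs3E; lia.
suff /maxe : weight l e' = s by lia.
rewrite -Ee !weight_total Te /e' !coefs3E.
have E1 := congr1 (muln g) Ea1.
have E2 := congr1 (muln (g * m)) Ed.
by lia.
Qed.

Hypotheses (co_mn : coprime m n) (co_ga : coprime g a1)
  (lt_rn : r < n) (lt_tm : t < m).

(** These vectors arise from [(N - 1) * n] copies of [a2] by trading, [N - 1 - k] times, [n] copies
    of [a2] for [n - m] of [a1] and [m] of [a3], which keeps weight and total. The work lies in
    excluding a larger total. *)
Lemma max_coefs_extremal k : k < N ->
  max_coefs l ((N - 1) * n * a2)
    (coefs3 ((N - 1 - k) * (n - m)) (k * n) ((N - 1 - k) * m)).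
Proof.
move=> kN.
have Eq : (N - 1 - k) + k = N - 1 by lia.
set q := N - 1 - k in Eq *.
have Enm : (n - m) + m = n by rewrite subnK // ltnW.
have T0 : total l (coefs3 (q * (n - m)) (k * n) (q * m)) = (N - 1) * n.
  rewrite totalE !coefs3E -Eq.
  by have := congr1 (muln q) Enm; lia.
split; first by rewrite weight_total T0 !coefs3E -Eq /a2; lia.
move=> e; rewrite weight_total T0 => Ee; rewrite leqNgt; apply/negP => ltT.
have Ej := subnKC (ltnW ltT); set j := total l e - _ in Ej.
have j_gt0 : 0 < j by rewrite subn_gt0.
have Ej2 : j * a1 + g * (m * e a2 + n * e a3) = g * ((N - 1) * m * n).
  by move: Ee; rewrite -Ej /a2; lia.
(* By [Ej2], [g] divides [j * a1], and it is coprime to [a1]. *)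
have /dvdnP[i Ei] : g %| j.
  rewrite -(Gauss_dvdl j co_ga).
  by rewrite -(dvdn_addl _ (dvdn_mulr (m * e a2 + n * e a3) (dvdnn g))) Ej2 dvdn_mulr.
have {}Ej2 : i * a1 + (m * e a2 + n * e a3) = (N - 1) * m * n.
  by apply/eqP; rewrite -(eqn_pmul2l g_gt0) -Ej2 Ei; apply/eqP; lia.
have i_gt0 : 0 < i by move: j_gt0; rewrite Ei; case: i {Ei Ej2}.
(* [u] and [w] are shifted by [i] to remain natural numbers. *)
have [u Eu] : exists u : nat, e a2 + i * n = i * r + u * n.
  (* Eliminating [i * a1] between [Ej2] and [i] times [Ea1] makes [e a2] congruent to [i * r] modulo
     [n]. *)
  have E : m * e a2 + n * (e a3 + i * N * m) = m * (i * r) + n * (i * t + (N - 1) * m).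
    by have := congr1 (muln i) Ea1; lia.
  have le_r : i * r <= e a2 + i * n by rewrite ltnW // ltn_addl // ltn_pmul2l.
  have /eqP := coprime_lin_modn co_mn E.
  rewrite -(modnMDl i (e a2)) addnC eqn_mod_dvd // => /dvdnP[u Eu].
  by exists u; rewrite -Eu subnKC.
have [w Ew] : exists w : nat, e a3 + i * m = i * t + w * m.
  have E : n * e a3 + m * (e a2 + i * N * n) = n * (i * t) + m * (i * r + (N - 1) * n).
    by have := congr1 (muln i) Ea1; lia.
  have le_t : i * t <= e a3 + i * m by rewrite ltnW // ltn_addl // ltn_pmul2l.
  have co_nm : coprime n m by rewrite coprime_sym.
  have /eqP := coprime_lin_modn co_nm E.
  rewrite -(modnMDl i (e a3)) addnC eqn_mod_dvd // => /dvdnP[w Ew].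
  by exists w; rewrite -Ew subnKC.
have u_gt0 : 0 < u.
  have : i * r < i * n by rewrite ltn_pmul2l.
  by case: (u) Eu => //; lia.
have w_gt0 : 0 < w.
  have : i * t < i * m by rewrite ltn_pmul2l.
  by case: (w) Ew => //; lia.
(* [m] times [Eu] plus [n] times [Ew], with [i * a1] eliminated again. *)
have : (u + w + i * N) * (m * n) = (N - 1 + 2 * i) * (m * n).
  have := congr1 (muln m) Eu.
  have := congr1 (muln n) Ew.
  have := congr1 (muln i) Ea1.
  by lia.
have mn_gt0 : 0 < m * n by rewrite muln_gt0 m_gt0 (ltn_trans m_gt0 lt_mn).
move=> /eqP; rewrite eqn_pmul2r // => /eqP E.
(* [N = 0] would contradict [0 < a1] in [Ea1]. For [N = 1] the right side of [Ej2] vanishes. *)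
have [N1|N2] : N = 1 \/ 2 <= N.
  by case: (N) Ea1 => [|[|N']]; [lia | left | right].
  have : 0 < i * a1 by rewrite muln_gt0 i_gt0.
  by move: Ej2; rewrite N1 subnn !mul0n; lia.
(* This is [0 <= (i - 1) * (N - 2)], and it contradicts [E] because [u + w] is at least 2. *)
have : N + 2 * i <= i * N + 2.
  by case: (i) i_gt0 => // i' _; case: (N) N2 => [|[|N']] // _; lia.
by lia.
Qed.

End ThreeGenerators.

(** * From ceilings of rationals to the natural numbers [N], [r] and [t] *)

Import Order.TTheory GRing.Theory Num.Theory.

Local Open Scope ring_scope.

(** Multiplying [X - 1 < x / n <= X] by [n] puts [n * X - x] in the range from 0 to [n - 1]. *)
Lemma ceil_divP (x : int) (n : nat) : (0 < n)%N ->
  exists2 r : nat, (r < n)%N &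
    n%:Z * Num.ceil (x%:~R / n%:R : rat) = x + r%:Z.
Proof.
move=> n_gt0; have nR_gt0 : 0 < n%:R :> rat by rewrite ltr0n.
set X := Num.ceil _; have /andP[] := ceil_itv (x%:~R / n%:R : rat).
rewrite -/X ltr_pdivlMr // ler_pdivrMr // -[n%:R]/(n%:Z%:~R) -!intrM ltr_int ler_int.
move=> ltX leX; exists (absz (n%:Z * X - x)%R); lia.
Qed.

Theorem theorem3p6 (a1 a2 a3 : nat) (ha1 : (0 < a1)%N) (h12 : (a1 < a2)%N)
    (h23 : (a2 < a3)%N) (hgcd : gcdn a1 (gcdn a2 a3) = 1%N) :
  let g := gcdn (a2 - a1) (a3 - a1) in
  let m := ((a2 - a1) %/ g)%N in
  let n := ((a3 - a1) %/ g)%N in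
  forall x y : int, m%:Z * x + n%:Z * y = a1%:Z ->
  exists2 d : nat, is_dmax (gen3 a1 a2 a3) d &
    d%:Z = Num.ceil (x%:~R / n%:R : rat) + Num.ceil (y%:~R / m%:R : rat).
Proof.
move=> g m n x y Exy.
have g_gt0 : (0 < g)%N by rewrite gcdn_gt0 subn_gt0 h12.
have Egm : (g * m = a2 - a1)%N by rewrite mulnC divnK ?dvdn_gcdl.
have Egn : (g * n = a3 - a1)%N by rewrite mulnC divnK ?dvdn_gcdr.
have Ea2 : (a2 = a1 + g * m)%N by lia.
have Ea3 : (a3 = a1 + g * n)%N by lia.
have m_gt0 : (0 < m)%N by rewrite -(ltn_pmul2l g_gt0); lia.
have lt_mn : (m < n)%N by rewrite -(ltn_pmul2l g_gt0); lia.
have co_mn : coprime m n.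
  by rewrite /coprime -(eqn_pmul2l g_gt0) muln_gcdr Egm Egn muln1.
(* A common divisor of [g] and [a1] also divides [a2] and [a3]. *)
have co_ga : coprime g a1.
  rewrite /coprime -dvdn1 -hgcd !dvdn_gcd dvdn_gcdr Ea2 Ea3.
  by rewrite !dvdn_add ?dvdn_gcdr ?dvdn_mulr ?dvdn_gcdl.
have [r lt_rn Er] := ceil_divP x (ltn_trans m_gt0 lt_mn).
have [t lt_tm Et] := ceil_divP y m_gt0.
set X := Num.ceil _ in Er *; set Y := Num.ceil _ in Et *.
have EN : a1%:Z + (m * r + n * t)%N%:Z = (X + Y) * (m * n)%N%:Z.
  rewrite -Exy !PoszD !PoszM.
  have := congr1 ( *%R m%:Z) Er; have := congr1 ( *%R n%:Z) Et.
  lia.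
(* One of [x] and [y] may be negative, but the left side of [EN] is positive; so the absolute value
   defining [N] changes nothing. *)
have XY_gt0 : 0 < X + Y.
  have mn_gt0 : 0 < (m * n)%N%:Z by rewrite ltz_nat muln_gt0 m_gt0 (ltn_trans m_gt0).
  by rewrite -(pmulr_lgt0 _ mn_gt0) -EN; lia.
pose N := absz (X + Y)%R.
have NE : N%:Z = X + Y by rewrite /N; lia.
have Ea1 : (m * r + n * t + a1 = N * m * n)%N.
  by rewrite -mulnA; move: EN; rewrite -NE -!PoszM -PoszD => -[<-]; rewrite addnC.
exists N => //.
have numS := gen3_numerical_semigroup ha1 hgcd.
pose l := [:: a1; a2; a3].
have sorted_l : sorted ltn l by rewrite /= h12 h23.
have l0 : 0%N \notin l by rewrite !inE; lia.
have genS s : gen3 a1 a2 a3 s <-> exists e, weight l e = s.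
  split=> [[c1 [c2 [c3 ->]]]|[e <-]].
    exists (coefs3 a1 g m c1 c2 c3); rewrite /weight !big_cons big_nil /coefs3.
    rewrite -Ea2 !eqxx (gtn_eqF h12) (gtn_eqF h23) (gtn_eqF (ltn_trans h12 h23)).
    by rewrite addn0 addnA.
  exists (e a1), (e a2), (e a3).
  by rewrite /weight !big_cons big_nil addn0 addnA.
have le_N s : (dmax_at (gen3 a1 a2 a3) s <= N)%N.
  have n_gt0 := ltn_trans m_gt0 lt_mn.
  (* The residue of [e a2] modulo [n] is forced, so the quotient serves as label; it is below [N]
     because [e a2 < N * n]. *)
  apply: (dmax_at_le numS sorted_l l0 genS (f := fun e => (e a2 %/ n)%N)).
    move=> e; rewrite ltn_divLR // /l Ea2 Ea3.
  exact: max_coefs_lt Ea1 _ _.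
  move=> e e'; rewrite /l Ea2 Ea3; exact: (max_coefs_inj ha1 g_gt0 m_gt0 lt_mn co_mn).
split; last by move=> s _; exact: le_N.
exists ((N - 1) * n * a2)%N.
  by exists 0%N, ((N - 1) * n)%N, 0%N; rewrite !mul0n add0n addn0.
apply/eqP; rewrite eqn_leq le_N /=.
apply: (dmax_at_ge numS sorted_l l0 genS (h := fun k =>
  coefs3 a1 g m ((N - 1 - k) * (n - m)) (k * n) ((N - 1 - k) * m))) => [k kN|].
  rewrite /l Ea2 Ea3.
  exact: (max_coefs_extremal ha1 g_gt0 m_gt0 lt_mn Ea1 co_mn co_ga lt_rn lt_tm kN).
(* The coefficient [k * n] of [a2] already separates the vectors. *)
move=> j k _ _ /(_ a2); rewrite !inE eqxx orbT => /(_ isT).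
rewrite /coefs3 -Ea2 (gtn_eqF h12) eqxx => /eqP.
by rewrite eqn_pmul2r ?(ltn_trans m_gt0) // => /eqP.
Qed.
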